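(* Let $f\in\mathcal{D}([a,b])$ and $h>0$. Then $$\omega^{(M_1)}_h(f)\leq\min\bigl\{\omega^+_h(f),\,\omega^-_h(f)\bigr\}.$$
   Context: $[a,b]\subset\mathbb{R}$ is a compact interval and $\mathcal{D}([a,b])$ is the space of càdlàg functions on $[a,b]$ (right-continuous with left limits; following Skorokhod, also left-continuous at $b$). For real $x,y,c$, $d(c;[x,y])$ is the distance between $c$ and the closed interval with endpoints $x$ and $y$ (that is, $[y,x]$ if $y<x$). The $M_1$ modulus of continuity is $$\omega^{(M_1)}_h(f)=\sup_{u,u',u''\in[a,b]:\,u-h\leq u'\leq u\leq u''\leq u+h}d\bigl(f(u);[f(u'),f(u'')]\bigr).$$ With $x_+=\max\{x,0\}$ and $x_-=\max\{-x,0\}$, the modulus of increase and the modulus of decrease are $$\omega^+_h(f)=\sup_{u,v\in[a,b]:\,u\leq v\leq u+h}\bigl(f(v)-f(u)\bigr)_+,\qquad \omega^-_h(f)=\sup_{u,v\in[a,b]:\,u\leq v\leq u+h}\bigl(f(v)-f(u)\bigr)_-.$$ *)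

(* Defs.v *)
From HB Require Import structures.
From mathcomp Require Import all_boot all_order all_algebra.
From mathcomp Require Import all_classical all_reals all_analysis.

Set Implicit Arguments.
Unset Strict Implicit.
Unset Printing Implicit Defensive.

Import Order.TTheory GRing.Theory Num.Theory.
Import numFieldNormedType.Exports.

Local Open Scope classical_set_scope.
Local Open Scope ring_scope.

(* A function on [a, b] is represented by a total function R -> R; everything
   below depends only on its values on `[a, b]. The guard [a < b] in the last
   clause matters when a = b, where left-continuity within [a, b] is vacuous. *)
Definition cadlag (R : realType) (a b : R) (f : R -> R) : Prop :=
  [/\ forall x, a <= x < b -> f t @[t --> x^'+] --> f x,
      forall x, a < x <= b -> exists l : R, f t @[t --> x^'-] --> l
    & a < b -> f t @[t --> b^'-] --> f b].

Definition segment (R : realType) (x y : R) : set R :=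
  `[Num.min x y, Num.max x y]%classic.

(* Suprema are taken in \bar R: [sup] on R returns 0 on unbounded sets. *)
Definition M1_modulus (R : realType) (a b : R) (h : R) (f : R -> R) : \bar R :=
  ereal_sup [set e | exists u u' u'' : R,
    [/\ u \in `[a, b], u' \in `[a, b], u'' \in `[a, b],
        u - h <= u' <= u /\ u <= u'' <= u + h
      & e = edist_inf (segment (f u') (f u'')) (f u)]].

Definition increase_modulus (R : realType) (a b : R) (h : R) (f : R -> R) :
    \bar R :=
  ereal_sup [set e | exists u v : R,
    [/\ u \in `[a, b], v \in `[a, b], u <= v <= u + h
      & e = (Num.max (f v - f u) 0)%:E]].

Definition decrease_modulus (R : realType) (a b : R) (h : R) (f : R -> R) :
    \bar R :=
  ereal_sup [set e | exists u v : R,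
    [/\ u \in `[a, b], v \in `[a, b], u <= v <= u + h
      & e = (Num.max (- (f v - f u)) 0)%:E]].

(* Main.v *)
(* If f u lies above both f u' and f u'', its distance to the segment is at most
   the increase from u' to u and at most the decrease from u to u''; if it lies
   below both, at most the increase from u to u'' and the decrease from u' to u.
   The bounds by decreases follow from those by increases upon swapping the
   endpoints of the segment. *)
Require Import Defs.
From HB Require Import structures.
From mathcomp Require Import all_boot all_order all_algebra.
From mathcomp Require Import all_classical all_reals all_analysis.

Import Order.TTheory GRing.Theory Num.Theory.
Import numFieldNormedType.Exports.

Local Open Scope ring_scope.

Lemma segmentC (R : realType) (x y : R) : segment x y = segment y x.
Proof. by rewrite /segment minC maxC. Qed.

Lemma edist_inf_le (R : realType) (V : normedModType R) (A : set V)
    (c p : V) :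
  A p -> (edist_inf A c <= `|c - p|%:E)%E.
Proof.
move=> Ap; apply: (@le_trans _ _ (edist (c, p))).
  by apply: ereal_inf_lbound; exists p.
(* Balls are open, so [p] lies in those around [c] only for radii above [|c - p|]; hence the slack
   [e]. *)
apply/lee_addgt0Pr => e e0; rewrite -EFinD; apply: edist_fin => /=.
  by rewrite ltr_wpDl.
by rewrite -ball_normE /= ltrDl.
Qed.

(** If [x <= c], compare [c] with the endpoint [x]; if [c <= y], with [y]. Otherwise [y < c < x], so
    [c] is in the segment. *)
Lemma edist_inf_segment_le (R : realType) (x y c : R) (e : \bar R) :
  ((Num.max (c - x) 0)%:E <= e)%E -> ((Num.max (y - c) 0)%:E <= e)%E ->
  (edist_inf (segment x y) c <= e)%E.
Proof.
move=> hx hy; have [xc|cx] := leP x c.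
  apply: (le_trans _ hx); rewrite max_l ?subr_ge0//.
  rewrite -[c - x]ger0_norm ?subr_ge0//; apply: edist_inf_le.
  by rewrite /segment /= in_itv /= ge_min le_max lexx.
have [cy|yc] := leP c y.
  apply: (le_trans _ hy); rewrite max_l ?subr_ge0//.
  rewrite -[y - c]ger0_norm ?subr_ge0// distrC; apply: edist_inf_le.
  by rewrite /segment /= in_itv /= ge_min le_max lexx !orbT.
apply: (le_trans _ (le_trans _ hx)).
  apply: (edist_inf_le _ _ _ _ c).
  by rewrite /segment /= in_itv /= ge_min le_max (ltW yc) (ltW cx) orbT.
by rewrite subrr normr0 lee_fin le_max lexx orbT.
Qed.

Theorem theorem17 (R : realType) (a b : R) (f : R -> R) (h : R)
    (hab : a <= b) (hf : cadlag a b f) (hh : 0 < h) :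
  (M1_modulus a b h f
     <= Order.min (increase_modulus a b h f) (decrease_modulus a b h f))%E.
Proof.
apply: ge_ereal_sup => e [u [u' [u'' [uab u'ab u''ab]]]].
case=> /andP[hu' u'u] /andP[uu'' hu''] ->.
have u'_le : u' <= u <= u' + h by rewrite u'u -lerBlDr.
have u''_le : u <= u'' <= u + h by rewrite uu''.
rewrite le_min; apply/andP; split.
  by apply: edist_inf_segment_le; apply: ereal_sup_ubound;
    [exists u', u|exists u, u''].
(* With [f u''] as first endpoint, the two bounds required are the drops from [u] to [u''] and from
   [u'] to [u]. *)
rewrite segmentC.
by apply: edist_inf_segment_le; apply: ereal_sup_ubound;
  [exists u, u''; rewrite opprB|exists u', u; rewrite opprB].
Qed.
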